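(* Let $A=(a_{j,k})_{j,k\in\mathbb{N}}$ be a Köthe matrix satisfying $$\forall n\in\mathbb{N},\ \exists m>n \text{ such that } \sup_{j\in\mathbb{N}}\left|\frac{a_{j,n}}{a_{j+1,m}}\right|<+\infty,$$ where whenever $a_{j+1,m}=0$ it is required that $a_{j,n}=0$, and $\frac{0}{0}$ is then read as $1$. Let $1\le p<+\infty$ or $p=0$, and let $B:\lambda_p(A)\to\lambda_p(A)$, $B(x_1,x_2,x_3,\ldots)=(x_2,x_3,x_4,\ldots)$, be the backward shift. Suppose there exist $x,y\in\lambda_p(A)$ and $\delta>0$ such that $\Phi_{x,y}(\delta)=0$, where $\Phi_{x,y}$ is the lower distributional function generated by $B$, $x$ and $y$. Then for any $0<\varepsilon<\delta$, $B$ has an invariant distributionally $\varepsilon$-scrambled subset $D\subset\lambda_p(A)$.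
   Context: $\mathbb{N}=\{1,2,3,\ldots\}$ and $\mathbb{K}$ denotes the scalar field ($\mathbb{R}$ or $\mathbb{C}$). Köthe matrix: an infinite matrix $A=(a_{j,k})_{j,k\in\mathbb{N}}$ such that for every $j\in\mathbb{N}$ there exists some $k\in\mathbb{N}$ with $a_{j,k}>0$, and $0\le a_{j,k}\le a_{j,k+1}$ for all $j,k\in\mathbb{N}$. Köthe sequence space: for $1\le p<+\infty$, $$\lambda_p(A)=\left\{x\in\mathbb{K}^{\mathbb{N}}:\ \|x\|_k:=\Big(\sum_{j=1}^\infty |x_j a_{j,k}|^p\Big)^{1/p}<\infty,\ \forall k\in\mathbb{N}\right\},$$ and for $p=0$, $$\lambda_0(A)=\left\{x\in\mathbb{K}^{\mathbb{N}}:\ \lim_{j\to\infty}x_j a_{j,k}=0,\ \forall k\in\mathbb{N}\right\},\qquad \|x\|_k:=\sup_{j\in\mathbb{N}}|x_j a_{j,k}|.$$ The space $\lambda_p(A)$ carries the complete translation-invariant metric $$d(x,y)=\sum_{n=1}^\infty\frac{1}{2^n}\frac{\|x-y\|_n}{1+\|x-y\|_n}.$$ The backward shift $B$ is well defined and continuous on $\lambda_p(A)$ if and only if the matrix condition in the claim holds. Distributional functions: for a continuous map $f:X\to X$ on a metric space $(X,d)$, $x,y\in X$, $n\in\mathbb{N}$ and $t\in\mathbb{R}$, let $$\Phi^{(n)}_{x,y}(t)=\left|\{0\le i<n:\ d(f^i(x),f^i(y))<t\}\right|$$ (where $|\cdot|$ denotes cardinality). The lower and upper distributional functions generated by $f$,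 $x$, $y$ are $$\Phi_{x,y}(t)=\liminf_{n\to\infty}\frac1n\Phi^{(n)}_{x,y}(t),\qquad \Phi^*_{x,y}(t)=\limsup_{n\to\infty}\frac1n\Phi^{(n)}_{x,y}(t).$$ A subset $D\subset X$ is distributionally $\varepsilon$-scrambled (for $f$) if for any distinct points $x,y\in D$, $\Phi^*_{x,y}(t)=1$ for any $t>0$ and $\Phi_{x,y}(\varepsilon)=0$. A subset $D$ is invariant (for $f$) if $f(D)\subset D$. *)

(* Defs.v *)
From HB Require Import structures.
From mathcomp Require Import all_boot all_order all_algebra.
From mathcomp Require Import complex.
From mathcomp Require Import all_classical all_reals all_analysis.
Set Implicit Arguments.
Unset Strict Implicit.
Unset Printing Implicit Defensive.
Import Order.TTheory GRing.Theory Num.Theory.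
Import numFieldNormedType.Exports.
Local Open Scope classical_set_scope.
Local Open Scope ring_scope.

(* All indices are shifted by one: the index i : nat stands for i + 1 in
   {1, 2, 3, ...}. *)

Variant scalar_kind := RealScalars | ComplexScalars.

Definition scalar_field (R : realType) (s : scalar_kind) : numFieldType :=
  match s with RealScalars => R | ComplexScalars => R[i] end.

(* The norm of R[i] is R[i]-valued; normc is its R-valued version. *)
Definition modulus (R : realType) (s : scalar_kind) : scalar_field R s -> R :=
  match s return scalar_field R s -> R with
  | RealScalars => fun x : R => `|x|
  | ComplexScalars => fun z : R[i] => Normc.normc z
  end.

Section Koethe.
Variable R : realType.
Implicit Types (A : nat -> nat -> R) (p : R) (s : scalar_kind).

Definition koethe_matrix A :=
  (forall j, exists k, 0 < A j k) /\
  (forall j k, 0 <= A j k /\ A j k <= A j k.+1).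

(* The exponent p = 0 selects the sup-seminorms; since matrix entries are
   nonnegative, |x_j a_(j,k)| is |x_j| a_(j,k). *)
Definition koethe_seminorm s p A (k : nat) (x : nat -> scalar_field R s) : \bar R :=
  if p == 0 then ereal_sup (range (fun j => (modulus (x j) * A j k)%:E))
  else ((\sum_(0 <= j <oo) ((modulus (x j) * A j k) `^ p)%:E) `^ p^-1)%E.

Definition koethe_space s p A : set (nat -> scalar_field R s) :=
  [set x | forall k,
    if p == 0 then (fun j => modulus (x j) * A j k) @ \oo --> (0 : R)
    else (koethe_seminorm p A k x < +oo)%E].

(* On the Koethe space all seminorms are finite, so fine loses nothing; outside
   of it the value of koethe_dist is irrelevant. *)
Definition koethe_dist s p A (x y : nat -> scalar_field R s) : R :=
  let q n := fine (koethe_seminorm p A n (fun j => x j - y j)) in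
  limn (series (fun n => 2^-1 ^+ n.+1 * (q n / (1 + q n)))).

Definition backward_shift s (x : nat -> scalar_field R s) : nat -> scalar_field R s :=
  fun j => x j.+1.

Definition koethe_ratio (a b : R) : R :=
  if (a == 0) && (b == 0) then 1 else a / b.

Definition shift_condition A :=
  forall n, exists m, [/\ (n < m)%N,
    (forall j, A j.+1 m = 0 -> A j n = 0) &
    has_ubound (range (fun j => `|koethe_ratio (A j n) (A j.+1 m)|))].

End Koethe.

Section Distributional.
Variables (R : realType) (X : Type) (d : X -> X -> R) (f : X -> X).

Definition closeness_count (x y : X) (n : nat) (t : R) : nat :=
  #|[pred i : 'I_n | d (iter i f x) (iter i f y) < t]|.

Definition lower_distributional (x y : X) (t : R) : \bar R :=
  limn_einf (fun n => ((closeness_count x y n t)%:R / n%:R : R)%:E).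

Definition upper_distributional (x y : X) (t : R) : \bar R :=
  limn_esup (fun n => ((closeness_count x y n t)%:R / n%:R : R)%:E).

Definition distributionally_scrambled (e : R) (D : set X) :=
  forall x y, D x -> D y -> x <> y ->
    (forall t, 0 < t -> upper_distributional x y t = 1%E) /\
    lower_distributional x y e = 0%E.

Definition invariant_set (D : set X) := f @` D `<=` D.

End Distributional.

(* Main.v *)
Require Import Defs.
From HB Require Import structures.
From mathcomp Require Import all_boot all_order all_algebra.
From mathcomp Require Import complex.
From mathcomp Require Import all_classical all_reals all_analysis.
From mathcomp Require Import lra zify.
Set Implicit Arguments.
Unset Strict Implicit.
Unset Printing Implicit Defensive.
Import Order.TTheory GRing.Theory Num.Theory.
Import numFieldNormedType.Exports.
Local Open Scope classical_set_scope.
Local Open Scope ring_scope.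

(** The metric only sees z = x - y, and only the moduli of its coordinates: it
    is a monotone F-norm N of the profile |z| for which long heads of a
    profile approximate it and far tails are small (cvg_norm_head,
    cvg_norm_tail). The hypothesis says that, for suitable n, N (B^i z) >=
    delta for almost all i < n.

    Cut z into blocks [start k, base k.+1). The block starts so far to the
    right of base k that the orbit of what remains of z is small up to a time
    much longer than base k; it goes past a horizon, much longer than start k,
    before which nearly all B^i z are of norm at least delta, and it is so
    long that cutting z at its end leaves these norms at least epsilon
    (block_exists). Keep some of the blocks, put zeros elsewhere, and change
    signs inside the kept blocks. Any two sequences obtained in this way, or
    iterates of such sequences, are simultaneously close to 0 during almost
    all of each long gap, so their upper distributional function is 1
    (pair_upper). If for infinitely many k the difference of the two sequences
    dominates |z| on block k, then monotonicity of N makes the lower one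
    vanish at epsilon (pair_lower).

    It remains to get this domination for any two distinct members of the
    invariant set D of all iterates. For sequences built from distinct
    selections c, c' of blocks, infinitely many blocks are kept by c and
    removed by c', and a shift does not carry one block into another, the gaps
    being long. For B^j u and B^(j+r) u with the same u, z itself may be
    useless, as it could be nearly r-periodic. But |a - b| or |a + b| is at
    least |a|, so signs can be chosen along each residue class mod r so that
    consecutive terms differ by at least |z| (alternated_separated). Every r
    is served by infinitely many blocks of every selection. As selections
    range over binary sequences, D is uncountable. *)

(** * The metric built from a sequence of seminorms *)

Section Gauge.
Variable R : realType.
Implicit Types q : nat -> R.

Definition gauge_term q (n : nat) : R := 2^-1 ^+ n.+1 * (q n / (1 + q n)).
Definition gauge q : R := limn (series (gauge_term q)).

Lemma gauge_frac_le (a b : R) : 0 <= a -> a <= b -> a / (1 + a) <= b / (1 + b).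
Proof.
move=> a0 ab; have b0 := le_trans a0 ab.
by rewrite ler_pdivrMr ?ltr_wpDr// mulrAC ler_pdivlMr ?ltr_wpDr//; nra.
Qed.

Lemma gauge_frac_le1 (a : R) : 0 <= a -> a / (1 + a) <= 1.
Proof. by move=> a0; rewrite ler_pdivrMr ?ltr_wpDr// mul1r lerDr. Qed.

Lemma gauge_term_ge0 q n : 0 <= q n -> 0 <= gauge_term q n.
Proof.
by move=> q0; rewrite mulr_ge0 ?exprn_ge0 ?invr_ge0// divr_ge0// addr_ge0.
Qed.

Lemma gauge_partial_bounds q n m : (forall k, 0 <= q k) -> (n <= m)%N ->
  series (gauge_term q) n <= series (gauge_term q) m <=
  series (gauge_term q) n + 2^-1 ^+ n - 2^-1 ^+ m.
Proof.
move=> q0 nm; rewrite -(subnKC nm); elim: (m - n)%N => [|d /andP[lo hi]].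
  by rewrite addn0 addrK lexx.
rewrite addnS seriesSr.
have t0 := gauge_term_ge0 (q0 (n + d)%N).
have t1 : gauge_term q (n + d) <= 2^-1 ^+ (n + d).+1.
  by rewrite ler_piMr ?exprn_ge0 ?invr_ge0 ?gauge_frac_le1.
have e : (2^-1 : R) ^+ (n + d) = 2^-1 ^+ (n + d).+1 *+ 2.
  by rewrite [RHS]mulr2n [in RHS]exprSr -splitr.
rewrite e [_ *+ 2]mulr2n in hi.
by apply/andP; split; lra.
Qed.

Lemma is_cvg_gauge q : (forall k, 0 <= q k) -> cvgn (series (gauge_term q)).
Proof.
move=> q0; apply: nondecreasing_is_cvgn.
  by move=> n m nm; case/andP: (gauge_partial_bounds q0 nm).
exists 1 => _ [n _ <-].
have /andP[_] := gauge_partial_bounds q0 (leq0n n).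
have -> : series (gauge_term q) 0 = 0 by rewrite /series/= big_geq.
rewrite expr0 add0r => /le_trans; apply.
by rewrite gerBl exprn_ge0// invr_ge0.
Qed.

Lemma gauge_bounds q n : (forall k, 0 <= q k) ->
  series (gauge_term q) n <= gauge q <= series (gauge_term q) n + 2^-1 ^+ n.
Proof.
move=> q0; have cq := is_cvg_gauge q0; apply/andP; split.
  apply: limr_ge => //; exists n => // m /= nm.
  by case/andP: (gauge_partial_bounds q0 nm).
apply: limr_le => //; exists n => // m /= nm.
have /andP[_ /le_trans] := gauge_partial_bounds q0 nm; apply.
by rewrite gerBl exprn_ge0// invr_ge0.
Qed.

Lemma le_gauge q q' : (forall k, 0 <= q k <= q' k) -> gauge q <= gauge q'.
Proof.
move=> qq; apply: ler_lim.
- by apply: is_cvg_gauge => k; case/andP: (qq k).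
- by apply: is_cvg_gauge => k; case/andP: (qq k) => a /(le_trans a).
apply: nearW => n; apply: ler_sum => i _.
rewrite ler_wpM2l ?exprn_ge0 ?invr_ge0//.
by case/andP: (qq i); exact: gauge_frac_le.
Qed.

(** Dominated convergence: the terms of index at least n contribute at most
    2^-n, whatever the values of the seminorms. *)
Lemma cvg_gauge (Q : nat -> nat -> R) q :
  (forall M k, 0 <= Q M k) -> (forall k, 0 <= q k) ->
  (forall k, (fun M => Q M k) @ \oo --> q k) ->
  (fun M => gauge (Q M)) @ \oo --> gauge q.
Proof.
move=> Q0 q0 Qq; apply/cvgrPdist_lt => e e0.
have e2 : 0 < e / 2 by rewrite divr_gt0.
have [n ne] : exists n, (2^-1 : R) ^+ n < e / 2.
  have /cvgrPdist_lt/(_ _ e2) [n _ /(_ n (leqnn n))] :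
    (fun n => (2^-1 : R) ^+ n) @ \oo --> (0 : R).
    by apply: cvg_expr; rewrite ger0_norm ?invr_ge0// invf_lt1// ltr1n.
  by rewrite /= sub0r normrN ger0_norm ?exprn_ge0 ?invr_ge0// => h; exists n.
have cS : (fun M => series (gauge_term (Q M)) n) @ \oo -->
          series (gauge_term q) n.
  elim: n {ne} => [|n IHn].
    rewrite /series/= !big_geq//.
    by under eq_fun do rewrite big_geq//; exact: cvg_cst.
  rewrite seriesSr; under eq_fun do rewrite seriesSr.
  apply: cvgD; first exact: IHn.
  apply: cvgM; first exact: cvg_cst.
  apply: cvgM; first exact: Qq.
  apply: cvgV; first by rewrite gt_eqF// ltr_wpDr.
  by apply: cvgD; [exact: cvg_cst|exact: Qq].
move/cvgrPdist_lt/(_ _ e2) : cS.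
apply: filterS => M.
have /andP[a1 a2] := gauge_bounds n (Q0 M).
have /andP[b1 b2] := gauge_bounds n q0.
by rewrite !ltr_norml => /andP[c1 c2]; apply/andP; split; lra.
Qed.

End Gauge.

(** * Profiles: sequences of moduli *)

(** The space, its seminorms and its metric depend on a scalar sequence only
    through its moduli, so they are studied on real sequences. *)
Definition profile_seminorm (R : realType) (p : R) (A : nat -> nat -> R)
    (k : nat) (u : nat -> R) : \bar R :=
  if p == 0 then ereal_sup (range (fun j => (u j * A j k)%:E))
  else ((\sum_(0 <= j <oo) ((u j * A j k) `^ p)%:E) `^ p^-1)%E.

(** Locked, as unification would otherwise unfold the limit of the series. *)
HB.lock Definition profile_norm (R : realType) (p : R) (A : nat -> nat -> R)
    (u : nat -> R) : R :=
  gauge (fun k => fine (profile_seminorm p A k u)).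

Section Profiles.
Variables (R : realType) (p : R) (A : nat -> nat -> R).
Hypothesis (hp : 0 <= p) (A0 : forall j k, 0 <= A j k).
Implicit Types u v w : nat -> R.

Definition profile_space u := forall k,
  if p == 0 then (fun j => u j * A j k) @ \oo --> (0 : R)
  else (profile_seminorm p A k u < +oo)%E.

Definition head_part M u (j : nat) : R := if (j < M)%N then u j else 0.
Definition tail_part M u (j : nat) : R := if (M <= j)%N then u j else 0.

Let pow_ge0 u k j : (0 <= ((u j * A j k) `^ p)%:E)%E.
Proof. by rewrite lee_fin powR_ge0. Qed.

Local Notation q := (profile_seminorm p A).
Local Notation N := (profile_norm p A).

Lemma le_weighted u v k j : 0 <= u j <= v j ->
  0 <= u j * A j k <= v j * A j k.
Proof.
by move=> /andP[a b]; rewrite mulr_ge0//= ler_wpM2r.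
Qed.

Lemma le_powered u v k j : 0 <= u j <= v j ->
  (u j * A j k) `^ p <= (v j * A j k) `^ p.
Proof.
move=> /(le_weighted k) /andP[a b].
by apply: ge0_ler_powR => //; rewrite nnegrE// (le_trans a).
Qed.

Lemma profile_seminorm_ge0 u k : (forall j, 0 <= u j) ->
  (0 <= q k u)%E.
Proof.
move=> u0; rewrite /profile_seminorm; case: ifP => _; last exact: poweR_ge0.
apply: ereal_sup_ge; exists (u 0%N * A 0%N k)%:E; first by exists 0%N.
by rewrite lee_fin mulr_ge0.
Qed.

Lemma le_profile_seminorm u v k : (forall j, 0 <= u j <= v j) ->
  (q k u <= q k v)%E.
Proof.
move=> uv; rewrite /profile_seminorm; case: ifP => p0.
  apply: ge_ereal_sup => _ [j _ <-].
  apply: ereal_sup_ge; exists (v j * A j k)%:E; first by exists j.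
  by rewrite lee_fin; case/andP: (le_weighted k (uv j)).
apply: gt0_ler_poweR; rewrite ?invr_ge0//.
- by rewrite in_itv/= leey andbT nneseries_ge0.
- by rewrite in_itv/= leey andbT nneseries_ge0.
apply: lee_nneseries => [j _ _|j _ /=]; first exact: pow_ge0.
by rewrite lee_fin; exact: le_powered.
Qed.

Lemma profile_space_powE u : p != 0 ->
  profile_space u <->
  forall k, (\sum_(0 <= j <oo) ((u j * A j k) `^ p)%:E < +oo)%E.
Proof.
move=> p0; split=> h k; have := h k; rewrite /profile_seminorm (negbTE p0).
  by apply: lty_poweRy; rewrite invr_neq0.
exact: poweR_lty.
Qed.

Lemma profile_seminorm_fin u k : (forall j, 0 <= u j) -> profile_space u ->
  q k u \is a fin_num.
Proof.
move=> u0 su; rewrite ge0_fin_numE ?profile_seminorm_ge0//.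
have := su k; case: ifP => p0 //.
move=> /cvgP /cvg_seq_bounded [C [_ /(_ (C + 1))]].
rewrite ltrDl ltr01 => /(_ isT) hC; rewrite /profile_seminorm p0.
apply: (@le_lt_trans _ _ (C + 1)%:E); last exact: ltry.
apply: ge_ereal_sup => _ [j _ <-]; rewrite lee_fin.
by rewrite (le_trans (ler_norm _))// hC.
Qed.

Lemma sub_profile_space u v : (forall j, 0 <= u j <= v j) ->
  profile_space v -> profile_space u.
Proof.
move=> uv sv k; have := sv k; case: ifP => p0 h; last first.
  exact: le_lt_trans (le_profile_seminorm k uv) h.
apply: (@squeeze_cvgr _ _ _ _ (fun=> 0) (fun j => v j * A j k)) => //.
  by apply: nearW => j; exact: le_weighted.
exact: cvg_cst.
Qed.

(** For a positive exponent, a + b is at most twice the larger of a and b, so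
    (a + b)^p <= 2^p (a^p + b^p), which saves Minkowski's inequality. *)
Lemma profile_spaceD u v : (forall j, 0 <= u j) -> (forall j, 0 <= v j) ->
  profile_space u -> profile_space v -> profile_space (fun j => u j + v j).
Proof.
move=> u0 v0 su sv; have [/eqP p0|p0] := eqVneq p 0.
  move=> k; have := su k; have := sv k; rewrite p0 => hv hu.
  under eq_fun do rewrite mulrDl.
  by have h := cvgD hu hv; rewrite addr0 in h; exact: h.
apply/profile_space_powE => // k.
have := proj1 (profile_space_powE u p0) su k.
have := proj1 (profile_space_powE v p0) sv k.
move=> hv hu.
apply: (@le_lt_trans _ _ ((2 `^ p)%:E *
   (\sum_(0 <= j <oo) ((u j * A j k) `^ p)%:E +
    \sum_(0 <= j <oo) ((v j * A j k) `^ p)%:E)))%E; last first.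
  by rewrite lte_mul_pinfty ?lee_fin ?powR_ge0// lte_add_pinfty.
rewrite -nneseriesD// -nneseriesZl//; last by move=> *; rewrite adde_ge0.
apply: lee_nneseries => [j _ _|j _]; first by rewrite lee_fin powR_ge0.
rewrite -EFinD -EFinM lee_fin.
have a0 : 0 <= u j * A j k by rewrite mulr_ge0.
have b0 : 0 <= v j * A j k by rewrite mulr_ge0.
rewrite mulrDl; move: (u j * A j k) (v j * A j k) a0 b0 => a b a0 b0.
wlog ab : a b a0 b0 / a <= b.
  move=> H; have [ab|/ltW ba] := leP a b; first exact: H.
  by rewrite addrC (addrC (a `^ p)); exact: H.
apply: (@le_trans _ _ ((2 * b) `^ p)).
  by apply: ge0_ler_powR => //; rewrite ?nnegrE; lra.
rewrite powRM// ler_wpM2l ?powR_ge0// lerDr powR_ge0//.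
Qed.

(** The matrix condition bounds A j n by C * A j.+1 m, so the n-th seminorm of
    the shifted profile is at most C times the m-th one of u. *)
Lemma profile_space_shift u : shift_condition A -> (forall j, 0 <= u j) ->
  profile_space u -> profile_space (fun j => u j.+1).
Proof.
move=> hA u0 su.
have {}hA n : exists m C, 0 <= C /\ forall j, A j n <= C * A j.+1 m.
  have [m [_ hz [C hC]]] := hA n; exists m, (Num.max 0 C); split.
    by rewrite le_max lexx.
  move=> j; have [/[dup] b0 /hz ->|b0] := eqVneq (A j.+1 m) 0.
    by rewrite mulr_ge0// le_max lexx.
  have bp : 0 < A j.+1 m by rewrite lt_neqAle eq_sym b0 A0.
  rewrite -ler_pdivrMr// le_max; apply/orP; right.
  have := hC _ (imageP _ (I : setT j)).
  rewrite /koethe_ratio (negbTE b0) andbF => /(le_trans _); apply.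
  exact: ler_norm.
have [/eqP p0|p0] := eqVneq p 0.
  move=> k; rewrite p0; have [m [C [C0 hC]]] := hA k.
  have := su m; rewrite p0 => cu.
  apply: (@squeeze_cvgr _ _ _ _ (fun=> 0) (fun j => C * (u j.+1 * A j.+1 m))).
  - apply: nearW => j; rewrite mulr_ge0//= mulrCA.
    by rewrite ler_wpM2l.
  - exact: cvg_cst.
  have cu' : (fun j => u j.+1 * A j.+1 m) @ \oo --> (0 : R).
    by rewrite (cvg_shiftS (fun j => u j * A j m)).
  by have h := cvgM (cvg_cst C) cu'; rewrite mulr0 in h; exact: h.
apply/profile_space_powE => // k; have [m [C [C0 hC]]] := hA k.
have := proj1 (profile_space_powE u p0) su m => hu.
apply: (@le_lt_trans _ _ ((C `^ p)%:E *
   (\sum_(0 <= j <oo) ((u j * A j m) `^ p)%:E)))%E; last first.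
  by rewrite lte_mul_pinfty ?lee_fin ?powR_ge0.
rewrite (@nneseries_recl _ xpredT (fun j => ((u j * A j m) `^ p)%:E))//=.
rewrite ge0_muleDr ?lee_fin ?powR_ge0//; last first.
  by apply: nneseries_ge0 => *; rewrite lee_fin powR_ge0.
rewrite -[X in (X <= _)%E]add0e; apply: leeD.
  by rewrite mule_ge0 ?lee_fin ?powR_ge0.
rewrite -(@nneseries_addn _ _ 1%N)//.
rewrite -nneseriesZl//.
apply: lee_nneseries => [j _ _|j _]; first by rewrite lee_fin powR_ge0.
rewrite -EFinM lee_fin -powRM// ?mulr_ge0//.
apply: ge0_ler_powR => //; rewrite ?nnegrE ?mulr_ge0//.
by rewrite addn1 mulrCA ler_wpM2l.
Qed.

Lemma cvg_powR (f : nat -> R) (l r : R) : 0 < r -> (forall n, 0 <= f n) ->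
  0 <= l -> f @ \oo --> l -> (fun n => f n `^ r) @ \oo --> l `^ r.
Proof.
move=> r0 f0; rewrite le_eqVlt => /predU1P[<-|l0] fl.
  rewrite powR0 ?gt_eqF//; apply/cvgrPdist_lt => e e0.
  have e'0 : 0 < e `^ r^-1 by rewrite powR_gt0.
  move/cvgrPdist_lt/(_ _ e'0): fl; apply: filterS => n.
  rewrite !sub0r !normrN !ger0_norm ?powR_ge0// => h.
  have -> : e = (e `^ r^-1) `^ r.
    by rewrite -powRrM mulVf ?gt_eqF// powRr1// ltW.
  by apply: gt0_ltr_powR => //; rewrite nnegrE ?powR_ge0.
have d : derivable (@powR R ^~ r) l 1.
  by apply: derivable_powR; rewrite in_itv/= l0.
have c : {for l, continuous (@powR R ^~ r)}.
  by apply/differentiable_continuous/derivable1_diffP.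
exact: (cvg_comp _ _ fl c).
Qed.

Lemma head_bounds M u : (forall j, 0 <= u j) ->
  forall j, 0 <= head_part M u j <= u j.
Proof. by move=> u0 j; rewrite /head_part; case: ifP; rewrite ?u0 ?lexx. Qed.

Lemma tail_bounds M u : (forall j, 0 <= u j) ->
  forall j, 0 <= tail_part M u j <= u j.
Proof. by move=> u0 j; rewrite /tail_part; case: ifP; rewrite ?u0 ?lexx. Qed.

(** For a positive exponent, the powers of these seminorms are the partial sums
    of a convergent series; a supremum is nearly attained at a single index. *)
Lemma cvg_seminorm_head u k : (forall j, 0 <= u j) -> profile_space u ->
  (fun M => fine (q k (head_part M u))) @ \oo -->
  fine (q k u).
Proof.
move=> u0 su; have [/eqP p0|p0] := eqVneq p 0.
  have Q0 := profile_seminorm_ge0 k u0.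
  have fu := profile_seminorm_fin k u0 su.
  have hu M : (q k (head_part M u) <= q k u)%E.
    by apply: le_profile_seminorm; exact: head_bounds.
  have h0 M : forall j, 0 <= head_part M u j.
    by move=> j; case/andP: (head_bounds M u0 j).
  have fh M : q k (head_part M u) \is a fin_num.
    apply: profile_seminorm_fin => //.
    by apply: (sub_profile_space (head_bounds M u0)).
  apply/cvgrPdist_lt => e e0.
  have [j hj] : exists j, fine (q k u) - e < u j * A j k.
    apply/not_existsP => H.
    have : (q k u <= (fine (q k u) - e)%:E)%E.
      rewrite [X in (X <= _)%E]/profile_seminorm p0.
      apply: ge_ereal_sup => _ [j _ <-]; rewrite lee_fin leNgt.
      by apply/negP; exact: H.
    by rewrite -{1}(fineK fu) lee_fin lerBrDr gerDl leNgt e0.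
  exists j.+1 => // M /= jM.
  rewrite ger0_norm ?subr_ge0 ?fine_le//.
  have : ((u j * A j k)%:E <= q k (head_part M u))%E.
    rewrite /profile_seminorm p0; apply: ereal_sup_ubound.
    by exists j => //; rewrite /head_part jM.
  rewrite -(fineK (fh M)) lee_fin => h.
  by rewrite ltrBlDr -ltrBlDl (lt_le_trans hj).
rewrite /profile_seminorm (negbTE p0).
under eq_fun do rewrite fine_poweR.
rewrite fine_poweR; apply: cvg_powR.
- by rewrite invr_gt0 lt_neqAle eq_sym p0.
- by move=> n; rewrite fine_ge0// nneseries_ge0.
- by rewrite fine_ge0// nneseries_ge0.
have fs := proj1 (profile_space_powE u p0) su k.
have cs := @is_cvg_nneseries _ (fun j => ((u j * A j k) `^ p)%:E) xpredT 0
  (fun n _ _ => pow_ge0 u k n).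
apply: fine_cvg; rewrite fineK; last first.
  by rewrite ge0_fin_numE// nneseries_ge0.
apply: cvg_trans cs.
apply: near_eq_cvg; apply: nearW => M /=.
rewrite (nneseries_split 0 M)// add0n.
rewrite [X in _ = (_ + X)%E]eseries0 ?adde0.
  rewrite !big_mkord; apply: eq_bigr => j _.
  by rewrite /head_part ltn_ord.
by move=> j Mj _; rewrite /head_part ltnNge Mj/= mul0r powR0.
Qed.

Lemma cvg_seminorm_tail u k : (forall j, 0 <= u j) -> profile_space u ->
  (fun M => fine (q k (tail_part M u))) @ \oo --> (0 : R).
Proof.
move=> u0 su; have [/eqP p0|p0] := eqVneq p 0.
  apply/cvgrPdist_le => e e0.
  have := su k; rewrite p0 => /cvgrPdist_le/(_ _ e0)[M0 _ hM].
  exists M0 => // M /= M0M.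
  have t0 : forall j, 0 <= tail_part M u j.
    by move=> j; case/andP: (tail_bounds M u0 j).
  have : (q k (tail_part M u) <= e%:E)%E.
    rewrite /profile_seminorm p0; apply: ge_ereal_sup => _ [j _ <-].
    rewrite lee_fin /tail_part; case: ifP => Mj; last by rewrite mul0r ltW.
    have := hM _ (leq_trans M0M Mj); rewrite /= sub0r normrN.
    exact: le_trans (ler_norm _).
  have fh : q k (tail_part M u) \is a fin_num.
    apply: profile_seminorm_fin => //.
    by apply: (sub_profile_space (tail_bounds M u0)).
  rewrite -{1}(fineK fh) lee_fin sub0r normrN ger0_norm// fine_ge0//.
  exact: profile_seminorm_ge0.
rewrite /profile_seminorm (negbTE p0).
under eq_fun do rewrite fine_poweR.
have -> : 0 = 0 `^ p^-1 :> R by rewrite powR0 ?invr_neq0.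
apply: cvg_powR => //.
- by rewrite invr_gt0 lt_neqAle eq_sym p0.
- by move=> n; rewrite fine_ge0// nneseries_ge0.
have fs := proj1 (profile_space_powE u p0) su k.
have := @nneseries_tail_cvg _ (fun j => ((u j * A j k) `^ p)%:E) xpredT fs
  (fun n _ => pow_ge0 u k n).
move=> cs; apply: fine_cvg.
apply: cvg_trans cs.
apply: near_eq_cvg; apply: nearW => M /=.
rewrite [RHS](nneseries_split 0 M)// add0n.
rewrite big1_seq ?add0e.
  rewrite eseries_cond [RHS]eseries_cond.
  by apply: eq_eseriesr => j /= Mj; rewrite /tail_part Mj.
move=> j /=; rewrite mem_index_iota => /andP[_ jM].
by rewrite /tail_part leqNgt jM/= mul0r powR0.
Qed.

Lemma profile_norm_le u v : (forall j, 0 <= u j <= v j) -> profile_space v ->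
  N u <= N v.
Proof.
move=> uv sv; rewrite profile_norm.unlock; apply: le_gauge => k.
have u0 j : 0 <= u j by case/andP: (uv j).
have v0 j : 0 <= v j by case/andP: (uv j) => /le_trans h /h.
rewrite fine_ge0 ?profile_seminorm_ge0//= fine_le ?profile_seminorm_fin//.
  exact: sub_profile_space uv sv.
exact: le_profile_seminorm.
Qed.

Lemma cvg_norm_head u : (forall j, 0 <= u j) -> profile_space u ->
  (fun M => N (head_part M u)) @ \oo --> N u.
Proof.
move=> u0 su; rewrite profile_norm.unlock; apply: cvg_gauge => [M k|k|k].
- rewrite fine_ge0// profile_seminorm_ge0// => j.
  by case/andP: (head_bounds M u0 j).
- by rewrite fine_ge0// profile_seminorm_ge0.
- exact: cvg_seminorm_head.
Qed.

Lemma cvg_norm_tail u : (forall j, 0 <= u j) -> profile_space u ->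
  (fun M => N (tail_part M u)) @ \oo --> (0 : R).
Proof.
move=> u0 su; rewrite profile_norm.unlock.
have -> : 0 = gauge (fun=> 0 : R).
  rewrite /gauge (_ : series _ = fun=> 0) ?lim_cst//.
  by apply/funext => n; rewrite /series/= big1// => i _;
    rewrite /gauge_term mul0r mulr0.
apply: cvg_gauge => [M k|k|k] //; last exact: cvg_seminorm_tail.
rewrite fine_ge0// profile_seminorm_ge0// => j.
by case/andP: (tail_bounds M u0 j).
Qed.

End Profiles.

Lemma koethe_distE (R : realType) s (p : R) A (x y : nat -> scalar_field R s) :
  koethe_dist p A x y = profile_norm p A (fun j => modulus (x j - y j)).
Proof. by rewrite profile_norm.unlock. Qed.

Lemma koethe_spaceE (R : realType) s (p : R) A (x : nat -> scalar_field R s) :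
  koethe_space p A x = profile_space p A (fun j => modulus (x j)).
Proof. by []. Qed.

(** * Counting close times *)

Section Limits.
Variable R : realType.
Implicit Types u : nat -> R.

Lemma limn_einf_eq0 u : (forall n, 0 <= u n) ->
  (forall e N, 0 < e -> exists2 n, (N <= n)%N & u n <= e) ->
  limn_einf (fun n => (u n)%:E) = 0%E.
Proof.
move=> u0 H; rewrite limn_einf_lim.
suff -> : einfs (fun n => (u n)%:E) = fun=> 0%E by rewrite lim_cst.
apply/funext => N; apply/eqP; rewrite eq_le; apply/andP; split.
  apply/lee_addgt0Pr => e e0; rewrite add0e.
  have [n Nn ue] := H e N e0.
  apply: (@le_trans _ _ (u n)%:E); last by rewrite lee_fin.
  by apply: ereal_inf_lbound; exists n.
by apply: le_ereal_inf_tmp => _ [n _ <-]; rewrite lee_fin.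
Qed.

Lemma limn_einf_eq0_ex u e N : 0 < e ->
  limn_einf (fun n => (u n)%:E) = 0%E -> exists2 n, (N <= n)%N & u n < e.
Proof.
move=> e0 u0; apply/not_exists2P => H.
have : (e%:E <= limn_einf (fun n => (u n)%:E))%E.
  rewrite limn_einf_lim; apply: lime_ge; first exact: is_cvg_einfs.
  exists N => // M /= NM; apply: le_ereal_inf_tmp => _ [n /= Mn <-].
  rewrite lee_fin leNgt; apply/negP; case: (H n) => //.
  by rewrite (leq_trans NM).
by rewrite u0 lee_fin leNgt e0.
Qed.

Lemma limn_esup_eq1 u : (forall n, u n <= 1) ->
  (forall e N, 0 < e -> exists2 n, (N <= n)%N & 1 <= u n + e) ->
  limn_esup (fun n => (u n)%:E) = 1%E.
Proof.
move=> u1 H; rewrite limn_esup_lim.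
suff -> : esups (fun n => (u n)%:E) = fun=> 1%E by rewrite lim_cst.
apply/funext => N; apply/eqP; rewrite eq_le; apply/andP; split.
  by apply: ge_ereal_sup => _ [n _ <-]; rewrite lee_fin.
apply/lee_addgt0Pr => e e0.
have [n Nn ue] := H e N e0.
apply: (@le_trans _ _ ((u n)%:E + e%:E))%E; first by rewrite -EFinD lee_fin.
by apply: leeD => //; apply: ereal_sup_ubound; exists n.
Qed.

End Limits.

Section Counting.
Variables (R : realType) (X : Type) (d : X -> X -> R) (f : X -> X).

Lemma closeness_countE x y n t : closeness_count d f x y n t =
  (\sum_(0 <= i < n) (d (iter i f x) (iter i f y) < t)%R)%N.
Proof.
rewrite /closeness_count -sum1_card big_mkord big_mkcond/=.
by apply: eq_bigr => i _; rewrite inE; case: ifP.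
Qed.

Lemma closeness_count_le x y n t : (closeness_count d f x y n t <= n)%N.
Proof. by rewrite -[leqRHS]card_ord max_card. Qed.

Lemma closeness_ratio_bounds x y n t :
  0 <= ((closeness_count d f x y n t)%:R / n%:R : R) <= 1.
Proof.
rewrite divr_ge0//=; case: n => [|n]; first by rewrite invr0 mulr0.
by rewrite ler_pdivrMr// mul1r ler_nat closeness_count_le.
Qed.

(** The factor 3 leaves room for three sources of close times: a start-up phase,
    a shift of the time axis and the exceptional times of the original orbit. *)
Lemma lower_distributional_eq0 x y t :
  (forall K, exists2 k, (K <= k)%N & exists2 n, (k <= n)%N &
     (k.+1 * closeness_count d f x y n t <= 3 * n)%N) ->
  lower_distributional d f x y t = 0%E.
Proof.
move=> H; apply: limn_einf_eq0 => [n|e N e0].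
  by case/andP: (closeness_ratio_bounds x y n t).
have [k] := H (maxn N.+1 (Num.truncn (3 / e)).+1).
rewrite geq_max => /andP[Nk ek] [n kn cn].
exists n; first by rewrite (leq_trans _ kn)// ltnW.
have n0 : (0 < n)%N by lia.
rewrite ler_pdivrMr ?ltr0n//.
have : 3 / e < k%:R.
  by apply: (lt_le_trans (Num.Theory.truncnS_gt _)); rewrite ler_nat.
rewrite ltr_pdivrMr// => h3.
have : (k.+1%:R * (closeness_count d f x y n t)%:R <= 3 * n%:R :> R).
  by rewrite -!natrM ler_nat.
have : 0 < n%:R :> R by rewrite ltr0n.
have : 0 <= k%:R :> R by [].
rewrite -natr1; move: (k%:R : R) h3 => q h3 q0.
move: (n%:R : R) ((closeness_count d f x y n t)%:R : R) => a b a0 h.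
have q1 : 0 < q + 1 by lra.
rewrite -(ler_pM2l q1) (le_trans h)// mulrA ler_wpM2r ?ltW//.
rewrite mulrDl; lra.
Qed.

Lemma lower_distributional_eq0_ex x y t :
  lower_distributional d f x y t = 0%E ->
  forall k N, exists2 n, (N <= n)%N &
     (k.+1 * closeness_count d f x y n t <= n)%N.
Proof.
move=> H k N.
have k0 : 0 < k.+1%:R^-1 :> R by rewrite invr_gt0.
have [n Nn] := limn_einf_eq0_ex N.+1 k0 H.
have n0 : (0 < n)%N by lia.
rewrite ltr_pdivrMr ?ltr0n// -(ltr_pM2l (_ : 0 < k.+1%:R))// mulrA.
rewrite mulfV// mul1r -natrM ltr_nat => h.
by exists n; lia.
Qed.

Lemma upper_distributional_eq1 x y t :
  (forall K, exists2 k, (K <= k)%N & exists2 n, (k <= n)%N &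
     (k.+1 * (n - closeness_count d f x y n t) <= n)%N) ->
  upper_distributional d f x y t = 1%E.
Proof.
move=> H; apply: limn_esup_eq1 => [n|e N e0].
  by case/andP: (closeness_ratio_bounds x y n t).
have [k] := H (maxn N.+1 (Num.truncn (e^-1)).+1).
rewrite geq_max => /andP[Nk ek] [n kn cn].
exists n; first by rewrite (leq_trans _ kn)// ltnW.
have n0 : (0 < n)%N by lia.
have : e^-1 < k%:R.
  by apply: (lt_le_trans (Num.Theory.truncnS_gt _)); rewrite ler_nat.
rewrite -[e^-1]mul1r ltr_pdivrMr// => h3.
have : (k.+1%:R * (n%:R - (closeness_count d f x y n t)%:R) <= n%:R :> R).
  by rewrite -natrB ?closeness_count_le// -natrM ler_nat.
have : 0 < n%:R :> R by rewrite ltr0n.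
have : 0 <= k%:R :> R by [].
rewrite -natr1; move: (k%:R : R) h3 => q h3 q0.
move: (n%:R : R) ((closeness_count d f x y n t)%:R : R) => a b a0 h.
rewrite -lerBlDr ler_pdivlMr//.
have q1 : 0 < q + 1 by lra.
rewrite mulrBl mul1r lerBlDr -lerBlDl -(ler_pM2l q1) (le_trans h)//.
by rewrite mulrA -{1}[a]mul1r ler_wpM2r ?ltW// mulrDl; lra.
Qed.

Lemma lower_distributionalC x y t : (forall a b, d a b = d b a) ->
  lower_distributional d f x y t = lower_distributional d f y x t.
Proof.
move=> dC; congr limn_einf; apply/funext => n; rewrite !closeness_countE.
by under eq_bigr do rewrite dC.
Qed.

End Counting.

Lemma sum_shift_le (P : pred nat) n j :
  (\sum_(0 <= i < n) ((i + j < n) ==> P (i + j)%N) <=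
   \sum_(0 <= i < n) P i + j)%N.
Proof.
have -> : (\sum_(0 <= i < n) ((i + j < n) ==> P (i + j)%N) =
  \sum_(j <= i < n + j) ((i < n) ==> P i))%N.
  by rewrite -{3}[j]add0n big_addn addnK.
apply: (@leq_trans (\sum_(0 <= i < n + j) ((i < n) ==> P i))%N).
  by rewrite [leqRHS](@big_cat_nat _ _ _ j)//= ?leq_addl// leq_addl.
rewrite (@big_cat_nat _ _ _ n)//= ?leq_addr// leq_add//.
  by rewrite !big_nat leq_sum// => i /= ->.
apply: (@leq_trans (\sum_(n <= i < n + j) 1)%N).
  by apply: leq_sum => i _; case: (_ ==> _).
by rewrite sum_nat_const_nat muln1 addKn.
Qed.

(** * Choosing signs *)

Section Modulus.
Variables (R : realType) (s : scalar_kind).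
Implicit Types a b : scalar_field R s.

Lemma modulus_ge0 a : 0 <= modulus a.
Proof. by case: s a => //= -[x y]; rewrite sqrtr_ge0. Qed.

Lemma modulusN a : modulus (- a) = modulus a.
Proof. by case: s a => /= a; [exact: normrN|exact: normcN]. Qed.

Lemma modulus0 : modulus (0 : scalar_field R s) = 0.
Proof. by case: s => /=; [exact: normr0|exact: Normc.normc0]. Qed.

Lemma le_modulusD a b : modulus (a + b) <= modulus a + modulus b.
Proof. by case: s a b => /= a b; [exact: ler_normD|exact: le_normcD]. Qed.

Lemma le_modulusB a b : modulus (a - b) <= modulus a + modulus b.
Proof. by rewrite -(modulusN b) le_modulusD. Qed.

Lemma modulusBC a b : modulus (a - b) = modulus (b - a).
Proof. by rewrite -modulusN opprB. Qed.

(** Of the two numbers b and - b, one lies at distance at least |a| from a,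
    since the two differences add up to 2 a. *)
Definition opposing a b := if modulus a <= modulus (a - b) then b else - b.

Lemma modulus_opposing a b : modulus (opposing a b) = modulus b.
Proof. by rewrite /opposing; case: ifP; rewrite ?modulusN. Qed.

Lemma modulus_double a : modulus (a + a) = modulus a + modulus a.
Proof.
case: s a => /= a; rewrite -!mulr2n; first exact: normrMn.
exact: normcMn.
Qed.

Lemma le_modulusB_opposing a b : modulus a <= modulus (a - opposing a b).
Proof.
rewrite /opposing; case: ifPn => //; rewrite opprK -ltNge => h.
have := le_modulusD (a - b) (a + b).
by rewrite addrACA addNr addr0 modulus_double; lra.
Qed.

(** Along each residue class modulo r, the sign of every term is chosen so as to
    oppose the previous term. *)
Fixpoint alternated_class (z : nat -> scalar_field R s) r t q :=
  if q is q'.+1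
  then opposing (alternated_class z r t q') (z (q * r + t)%N)
  else z t.

Definition alternated z r x := alternated_class z r (x %% r) (x %/ r).

Lemma modulus_alternated z r x : modulus (alternated z r x) = modulus (z x).
Proof.
rewrite /alternated {3}(divn_eq x r).
by case: (x %/ r)%N => [|q] /=; rewrite ?modulus_opposing.
Qed.

Lemma alternated_separated z r x : (0 < r)%N ->
  modulus (z x) <= modulus (alternated z r x - alternated z r (x + r)).
Proof.
move=> r0; rewrite -(modulus_alternated z r x) {3}/alternated.
rewrite modnDr divnDr ?dvdnn// divnn r0 addn1 /=.
exact: le_modulusB_opposing.
Qed.

End Modulus.

(** * Uniform approximation along finitely many iterates *)

Section Orbits.
Variables (R : realType) (p : R) (A : nat -> nat -> R).
Hypothesis (hp : 0 <= p) (A0 : forall j k, 0 <= A j k).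
Hypothesis (hB : shift_condition A).
Variable m : nat -> R.
Hypotheses (m0 : forall x, 0 <= m x) (hm : profile_space p A m).

Definition advance T i (v : nat -> T) x := v (i + x)%N.

Lemma profile_space_advance i : profile_space p A (advance i m).
Proof.
elim: i => [|i IHi]; first exact: hm.
have := profile_space_shift hp A0 hB (fun x => m0 (i + x)%N) IHi.
by congr profile_space; apply/funext => x; rewrite /advance addnS.
Qed.

(** All iterates of index at most I of a far tail of m, and sums of two of them,
    are dominated by a far tail of the single profile
    2 (m + B m + ... + B^I m). *)
Lemma small_tails I t : 0 < t -> exists M, forall i i' v,
  (i <= I)%N -> (i' <= I)%N ->
  (forall x, 0 <= v x <= tail_part M m (i + x)%N + tail_part M m (i' + x)%N) ->
  profile_norm p A v < t.
Proof.
move=> t0; pose w x := (\sum_(0 <= i < I.+1) m (i + x)%N).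
have w0 x : 0 <= w x by rewrite sumr_ge0.
have hw : profile_space p A w.
  rewrite /w; elim: (I) => [|n IHn].
    have := hm; congr profile_space; apply/funext => x.
    by rewrite big_nat1.
  have := profile_spaceD hp A0 _ _ IHn (profile_space_advance n.+1).
  have -> : (fun x => \sum_(0 <= i < n.+2) m (i + x)%N) =
    (fun j => \sum_(0 <= i < n.+1) m (i + j)%N + advance n.+1 m j).
    by apply/funext => x; rewrite big_nat_recr.
  by apply => x; rewrite ?sumr_ge0// /advance.
have mw i x : (i <= I)%N -> m (i + x)%N <= w x.
  move=> iI; rewrite /w (@big_cat_nat _ _ _ i)//=; last by rewrite ltnW.
  by rewrite [X in _ <= _ + X]big_ltn// addrCA lerDl addr_ge0// sumr_ge0.
have ww0 x : 0 <= w x + w x by rewrite addr_ge0.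
have hww := profile_spaceD hp A0 w0 w0 hw hw.
have /cvgrPdist_lt/(_ _ t0)[M _ hM] := cvg_norm_tail hp A0 ww0 hww.
(* An index i + x >= M + I with i <= I forces x >= M. *)
exists (M + I)%N => i i' v iI i'I hv.
have := hM _ (leqnn M); rewrite /= sub0r normrN; apply: le_lt_trans.
apply: le_trans (ler_norm _).
apply: (profile_norm_le hp A0); last first.
  exact: (sub_profile_space hp A0 (tail_bounds M ww0) hww).
move=> x; case/andP: (hv x) => -> /= /le_trans; apply.
rewrite /tail_part; have [Mx|xM] := leqP M x.
  apply: lerD; case: ifP => _ //; exact: mw.
by rewrite !ifF ?addr0//; lia.
Qed.

(** The gap between epsilon and delta pays for cutting the profile, at a place that
    serves the first n iterates simultaneously. *)
Lemma heads_suffice eps delta n : eps < delta ->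
  exists b0, forall b, (b0 <= b)%N -> forall i, (i < n)%N ->
  delta <= profile_norm p A (advance i m) ->
  eps <= profile_norm p A (advance i (head_part b m)).
Proof.
move=> ed; elim: n => [|n [b0 IHn]].
  by exists 0%N => b _ i i0; exfalso; move: i0; rewrite ltn0.
have [b1 hb1] : exists b1, forall b, (b1 <= b)%N ->
    delta <= profile_norm p A (advance n m) ->
    eps <= profile_norm p A (advance n (head_part b m)).
  have [h|h] := leP delta (profile_norm p A (advance n m)); last first.
    by exists 0%N .
  have m0n x : 0 <= advance n m x by exact: m0.
  have /cvgrPdist_lt/(_ (delta - eps)) :=
    cvg_norm_head hp A0 m0n (profile_space_advance n).
  rewrite subr_gt0 => /(_ ed)[b1 _ hb1]; exists (b1 + n)%N => b bb1 _.
  have -> : advance n (head_part b m) = head_part (b - n) (advance n m).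
    by apply/funext => x; rewrite /advance /head_part ltn_subRL.
  have /hb1/= : (b1 <= b - n)%N by lia.
  by move/ltr_normlW; lra.
exists (maxn b0 b1) => b; rewrite geq_max => /andP[b0b b1b] i.
by rewrite ltnS leq_eqVlt => /predU1P[->|]; [exact: hb1|exact: IHn].
Qed.

End Orbits.

(** * The blocks *)

Section Blocks.
Variables (R : realType) (s : scalar_kind) (p : R) (A : nat -> nat -> R).
Hypothesis (hp : 0 <= p) (A0 : forall j k, 0 <= A j k).
Hypothesis (hB : shift_condition A).
Variable z : nat -> scalar_field R s.
Let m x := modulus (z x).
Hypotheses (hz : profile_space p A m).
Variables eps delta : R.
Hypothesis ed : eps < delta.
Hypothesis spread : forall k N, exists2 n, (N <= n)%N &
  (k.+1 * \sum_(0 <= i < n) (profile_norm p A (advance i m) < delta)%R <= n)%N.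

Let m0 x : 0 <= m x. Proof. exact: modulus_ge0. Qed.

(** The requirements on block k when everything before position a is already
    used; st is the triple (start, horizon, end). From time a to time (k + 1)
    (a + 1), that is, except for a proportion of at most 1 / (k + 1), an orbit
    sees nothing but zeros and the tail of z from the start on, which
    spec_small makes negligible; the extra k absorbs shifts by at most k. *)
Record block_spec k a (st : nat * nat * nat) : Prop := BlockSpec {
  spec_gap : (a + k < st.1.1)%N;
  spec_long : (k.+1 * st.1.1 <= st.1.2)%N;
  spec_end : (st.1.2 <= st.2)%N;
  spec_small : forall i i' v, (i <= k.+1 * a.+1 + k)%N ->
    (i' <= k.+1 * a.+1 + k)%N ->
    (forall x, 0 <= v x <=
       tail_part st.1.1 m (i + x)%N + tail_part st.1.1 m (i' + x)%N) ->
    profile_norm p A v < k.+1%:R^-1;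
  spec_spread : (k.+1 * \sum_(0 <= i < st.1.2)
    (profile_norm p A (advance i m) < delta)%R <= st.1.2)%N;
  spec_large : forall i, (i < st.1.2)%N ->
    delta <= profile_norm p A (advance i m) ->
    eps <= profile_norm p A (advance i (head_part st.2 m)) }.

Lemma block_exists k a : exists st, block_spec k a st.
Proof.
have k0 : 0 < k.+1%:R^-1 :> R by rewrite invr_gt0.
have [M hM] := small_tails hp A0 hB m0 hz (k.+1 * a.+1 + k)%N k0.
pose l := maxn M (a + k).+1.
have [n ln hn] := spread k (k.+1 * l)%N.
have [b hb] := heads_suffice hp A0 hB m0 hz n ed.
exists (l, n, maxn n b); split => //=.
- exact: leq_maxr.
- exact: leq_maxl.
- move=> i i' v hi hi' hv; apply: (hM i i') => // x.
  case/andP: (hv x) => -> /= /le_trans; apply.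
  have le_tail y : tail_part l m y <= tail_part M m y.
    rewrite /tail_part; case: ifP => [|_]; last by case: ifP.
    by rewrite geq_max => /andP[->].
  exact: lerD.
- by apply: hb; exact: leq_maxr.
Qed.

Definition next_block k a := projT1 (cid (block_exists k a)).

Fixpoint base k := if k is k'.+1 then (next_block k' (base k')).2 else 0%N.
Definition start k := (next_block k (base k)).1.1.
Definition horizon k := (next_block k (base k)).1.2.

Lemma blockP k : block_spec k (base k) (start k, horizon k, base k.+1).
Proof.
have : block_spec k (base k) (next_block k (base k)) := projT2 (cid _).
by rewrite /start /horizon /=; case: (next_block k (base k)) => -[].
Qed.

Local Arguments base : simpl never.

Lemma base_start k : (base k + k < start k)%N.
Proof. exact: spec_gap (blockP k). Qed.

Lemma start_base k : (start k <= base k.+1)%N.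
Proof.
have := spec_long (blockP k); have := spec_end (blockP k) => /=.
by move=> h1 h2; apply: leq_trans h1; apply: leq_trans h2; exact: leq_pmull.
Qed.

Lemma le_base k l : (k <= l)%N -> (base k <= base l)%N.
Proof.
move=> /subnKC <-; elim: (l - k)%N => [|n IHn]; first by rewrite addn0.
rewrite addnS (leq_trans IHn)//.
by have := base_start (k + n)%N; have := start_base (k + n)%N; lia.
Qed.

Definition in_block k x := (start k <= x < base k.+1)%N.

Lemma in_block_le k x : in_block k x -> (k <= x)%N.
Proof. by move=> /andP[h _]; have := base_start k; lia. Qed.

Lemma in_block_inj k l x : in_block k x -> in_block l x -> k = l.
Proof.
move=> /andP[k1 k2] /andP[l1 l2].
have := base_start k; have := base_start l.
by have [kl|lk|//] := ltngtP k l; [have := le_base kl|have := le_base lk]; lia.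
Qed.

(** The sequence equal to phi k on block k and to 0 off the blocks. As block k
    starts after k, the block of x has index at most x. *)
Definition glue (phi : nat -> nat -> scalar_field R s) x :=
  if [pick k : 'I_x.+1 | in_block k x] is Some k then phi k x else 0.

Lemma glue_in phi k x : in_block k x -> glue phi x = phi k x.
Proof.
move=> kx; rewrite /glue; case: pickP => [l lx|/(_ (Ordinal _))H].
  by rewrite (in_block_inj kx lx).
by have := H k (in_block_le kx); rewrite kx.
Qed.

Lemma glue_out phi x : (forall k, in_block k x = false) -> glue phi x = 0.
Proof. by move=> H; rewrite /glue; case: pickP => [l|//]; rewrite H. Qed.

Lemma glue_gap phi k x : (base k <= x < start k)%N -> glue phi x = 0.
Proof.
move=> /andP[h1 h2]; apply: glue_out => l; apply/negP => /andP[l1 l2].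
have [lk|kl] := ltnP l k; first by have := le_base lk; lia.
move: kl; rewrite leq_eqVlt => /predU1P[e|kl]; first by subst l; lia.
by have := le_base kl; have := base_start l; have := start_base k; lia.
Qed.

(** Gaps near block k are longer than k, so a shift by at most k which leaves
    block k lands in a gap. *)
Lemma glue_near phi k x d : in_block k x -> (d <= k)%N ->
  ~~ in_block k (x + d)%N -> glue phi (x + d)%N = 0.
Proof.
move=> /andP[x1 x2] dk H; apply: (@glue_gap _ k.+1).
by move: H; rewrite /in_block; have := base_start k.+1; lia.
Qed.

Lemma glue_near_left phi k x d : in_block k (x + d) -> (d <= k)%N ->
  ~~ in_block k x -> glue phi x = 0.
Proof.
move=> /andP[x1 x2] dk H; apply: (@glue_gap _ k).
by move: H; rewrite /in_block; have := base_start k; lia.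
Qed.

(** * Selecting the blocks *)

(** A block coded by (n, b, r, q) is kept by the selection c when c n = b, and
    serves the lag r; the component q makes each such task occur infinitely
    often. *)
Definition code := (nat * bool * nat * nat)%type.

Definition selected (c : nat -> bool) k :=
  if (unpickle k : option code) is Some (n, b, _, _) then c n == b else false.

Definition lag k :=
  if (unpickle k : option code) is Some (_, _, r, _) then r else 0%N.

Lemma codes_unbounded n b r K :
  exists2 k, (K <= k)%N & exists q, unpickle k = Some ((n, b, r, q) : code).
Proof.
pose f q := pickle ((n, b, r, q) : code).
have finj : injective f by move=> q q' /(pcan_inj pickleK)[].
have [/allP H|/allPn[_ /mapP[q _ ->]]] :=
    boolP (all (fun k => (k < K)%N) (map f (iota 0 K.+1))); last first.
  by rewrite -leqNgt => Kq; exists (f q) => //; exists q; exact: pickleK.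
have sub : {subset map f (iota 0 K.+1) <= iota 0 K}.
  by move=> k /H; rewrite mem_iota.
have := uniq_leq_size _ sub.
by rewrite map_inj_uniq// iota_uniq size_map !size_iota ltnn => /(_ isT).
Qed.

(** Each kept block uses the signs adapted to its own lag; the modulus is |z|
    for all of them. *)
Definition spliced c :=
  glue (fun k x => if selected c k then alternated z (lag k) x else 0).

Lemma le_spliced c x : modulus (spliced c x) <= m x.
Proof.
have [[k kx]|H] := pselect (exists k, in_block k x).
  rewrite /spliced (glue_in _ kx); case: ifP => _; last by rewrite modulus0.
  by rewrite modulus_alternated.
rewrite /spliced glue_out ?modulus0// => k.
by apply/negP => kx; apply: H; exists k.
Qed.

Lemma le_spliced_tail c k x : (base k <= x)%N ->
  modulus (spliced c x) <= tail_part (start k) m x.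
Proof.
move=> kx; rewrite /tail_part; case: leqP => [_|xk]; first exact: le_spliced.
by rewrite /spliced (@glue_gap _ k) ?modulus0// kx.
Qed.

Lemma modulus_spliced c k x : in_block k x -> selected c k ->
  modulus (spliced c x) = m x.
Proof.
by move=> kx ck; rewrite /spliced (glue_in _ kx) ck modulus_alternated.
Qed.

(** If x + lag k has left block k, then it lies in a gap, and the difference is
    just the term at x. *)
Lemma spliced_lag c k x : in_block k x -> selected c k -> (0 < lag k <= k)%N ->
  m x <= modulus (spliced c x - spliced c (x + lag k)%N).
Proof.
move=> kx ck /andP[r0 rk].
have [kxr|kxr] := boolP (in_block k (x + lag k)); last first.
  by rewrite {2}/spliced (glue_near _ kx rk kxr) subr0 (modulus_spliced kx ck).
rewrite /spliced (glue_in _ kx) (glue_in _ kxr) ck.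
exact: alternated_separated.
Qed.

Lemma spliced_unselected c k x j l : in_block k (x + j) -> ~~ selected c k ->
  (j <= k)%N -> (l <= k)%N -> spliced c (x + l)%N = 0.
Proof.
move=> kxj ck jk lk; rewrite /spliced.
have [kxl|kxl] := boolP (in_block k (x + l)).
  by rewrite (glue_in _ kxl) (negbTE ck).
have [lj|jl] := leqP l j.
  apply: (@glue_near_left _ k _ (j - l)%N _ _ kxl); last by lia.
  by rewrite -addnA subnKC.
have e : (x + l = x + j + (l - j))%N by lia.
by rewrite e in kxl *; apply: glue_near kxl => //; lia.
Qed.

Lemma spliced_space c : profile_space p A (fun x => modulus (spliced c x)).
Proof.
by apply: (sub_profile_space hp A0 _ hz) => x; rewrite modulus_ge0 le_spliced.
Qed.

(** * Distributional chaos of the spliced sequences *)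

Local Notation B := (@backward_shift R s).
Local Notation d := (koethe_dist p A).

Lemma iter_backward_shift i (u : nat -> scalar_field R s) :
  iter i B u = advance i u.
Proof.
elim: i => [|i IHi] //; rewrite iterS IHi.
by apply/funext => x; rewrite /backward_shift /advance addnS.
Qed.

Lemma iter_shift_dist i j l u v :
  d (iter i B (iter j B u)) (iter i B (iter l B v)) =
  profile_norm p A (fun x => modulus (u (i + j + x)%N - v (i + l + x)%N)).
Proof.
rewrite -!iterD !iter_backward_shift koethe_distE.
by [].
Qed.

Lemma pair_close c c' j l k i : (j <= k)%N -> (l <= k)%N ->
  (base k <= i < k.+1 * (base k).+1)%N ->
  d (iter i B (iter j B (spliced c))) (iter i B (iter l B (spliced c')))
    < k.+1%:R^-1.
Proof.
move=> jk lk /andP[i1 i2]; rewrite iter_shift_dist.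
apply: (spec_small (blockP k) (i := (i + j)%N) (i' := (i + l)%N));
  [lia|lia|move=> x].
rewrite modulus_ge0/=; apply: (le_trans (le_modulusB _ _)).
by apply: lerD; apply: le_spliced_tail; lia.
Qed.

Lemma pair_upper c c' j l t : 0 < t ->
  upper_distributional d B (iter j B (spliced c)) (iter l B (spliced c')) t
    = 1%E.
Proof.
move=> t0; apply: upper_distributional_eq1 => K.
pose k := maxn (maxn K (Num.truncn t^-1)) (maxn j l).
have jk : (j <= k)%N by rewrite /k; lia.
have lk : (l <= k)%N by rewrite /k; lia.
have tk : k.+1%:R^-1 <= t.
  rewrite invf_ple ?posrE//; apply: ltW.
  by apply: (lt_le_trans (Num.Theory.truncnS_gt _));
    rewrite ler_nat ltnS /k !leq_max leqnn orbT.
exists k; first by rewrite /k; lia.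
exists (k.+1 * (base k).+1)%N; first by rewrite mulnS; lia.
rewrite leq_mul2l/= closeness_countE.
rewrite leq_subLR.
have bn : (base k <= k.+1 * (base k).+1)%N by rewrite mulSn; lia.
rewrite (big_cat_nat (n := base k))//=.
have : (k.+1 * (base k).+1 - base k <= \sum_(base k <= i < k.+1 * (base k).+1)
   (d (iter i B (iter j B (spliced c)))
      (iter i B (iter l B (spliced c'))) < t)%R)%N.
  rewrite -[leqLHS]muln1 -sum_nat_const_nat !big_nat leq_sum// => i hi.
  by rewrite (lt_le_trans (pair_close c c' jk lk hi) tk).
lia.
Qed.

(** A time i before the horizon is close only if i < start k, or i + j0 reaches
    the horizon, or B^(i + j0) z has norm less than delta: otherwise the
    difference dominates B^(i + j0) applied to the head of z up to the end of
    block k, as positions before the start are shifted out. *)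
Lemma pair_lower c c' j l j0 :
  (forall K, exists2 k, (K <= k)%N & forall x, in_block k (x + j0) ->
    m (x + j0)%N <= modulus (spliced c (x + j)%N - spliced c' (x + l)%N)) ->
  lower_distributional d B (iter j B (spliced c)) (iter l B (spliced c')) eps
    = 0%E.
Proof.
move=> H; apply: lower_distributional_eq0 => K.
have [k] := H (maxn K j0); rewrite geq_max => /andP[Kk j0k] dom.
exists k => //; exists (horizon k).
  have := spec_long (blockP k); have := base_start k => /= h1 h2.
  by apply: leq_trans h2; apply: leq_trans (leq_pmull _ _) => //; lia.
pose close i := profile_norm p A (advance i m) < delta.
have key i : (i < horizon k)%N ->
    d (iter i B (iter j B (spliced c)))
      (iter i B (iter l B (spliced c'))) < eps ->
    (i < start k)%N || ((i + j0 < horizon k)%N ==> close (i + j0)%N).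
  move=> ih; rewrite iter_shift_dist => hd.
  rewrite leqNgt -implybE.
  apply/implyP => si; apply/implyP => ijh; rewrite /close ltNge.
  apply/negP => /(spec_large (blockP k) ijh); apply/negP; rewrite -ltNge.
  apply: le_lt_trans hd; apply: (profile_norm_le hp A0); last first.
    have h1 := profile_space_advance hp A0 hB m0 hz (i + j).
    have h2 := profile_space_advance hp A0 hB m0 hz (i + l).
    have := profile_spaceD hp A0 (fun x => m0 _) (fun x => m0 _) h1 h2.
    apply: (sub_profile_space hp A0) => x; rewrite modulus_ge0/=.
    by apply: (le_trans (le_modulusB _ _)); apply: lerD; exact: le_spliced.
  move=> x; rewrite /advance /head_part; case: ifP => [/= xb|_]; last first.
    by rewrite lexx modulus_ge0.
  rewrite m0/= -!addnA ![(_ + x)%N]addnC !addnA.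
  apply: dom; rewrite /in_block; lia.
rewrite closeness_countE.
apply: (@leq_trans (k.+1 * (\sum_(0 <= i < horizon k) (i < start k)%N +
  \sum_(0 <= i < horizon k) ((i + j0 < horizon k)%N ==> close (i + j0)%N)))).
  rewrite leq_mul2l/= -big_split/= !big_nat leq_sum// => i /= ih.
  case: (boolP (_ < eps)) => // /(key i ih).
  by case: (i < start k)%N => //= ->.
have h1 := sum_shift_le close (horizon k) j0.
have h2 := spec_spread (blockP k).
have h3 := spec_long (blockP k).
have h4 := base_start k.
have h5 : (\sum_(0 <= i < horizon k) (i < start k)%N <= start k)%N.
  have sh : (start k <= horizon k)%N.
    by apply: leq_trans h3; exact: leq_pmull.
  rewrite (big_cat_nat (n := start k))//=.
  rewrite [X in (_ + X)%N]big1_seq ?addn0.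
    rewrite -[leqRHS]muln1 -[X in (X * 1)%N]subn0 -sum_nat_const_nat.
    by apply: leq_sum => i _; case: (_ < _)%N.
  by move=> i; rewrite mem_index_iota => /andP[_ /andP[/leq_gtF ->]].
move: h1 h2 h3 h4 h5 => /=; rewrite -/close.
set a := \sum_(0 <= i < _) _; set b := \sum_(0 <= i < _) _.
set e := \sum_(0 <= i < _) _ => h1 h2 h3 h4 h5.
nia.
Qed.

Lemma not_separated_from_self (u : nat -> scalar_field R s) : 0 < eps ->
  lower_distributional d B u u eps <> 0%E.
Proof.
move=> e0 h; have [n n0] := lower_distributional_eq0_ex h 1 1.
rewrite closeness_countE (eq_bigr (fun=> 1%N)).
  by rewrite sum_nat_const_nat muln1 subn0; lia.
move=> i _; rewrite koethe_distE.
have -> : (fun x => modulus (iter i B u x - iter i B u x)) = fun=> 0.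
  by apply/funext => x; rewrite subrr modulus0.
have h0 : profile_space p A (fun=> 0).
  by apply: (sub_profile_space hp A0 _ hz) => x; rewrite lexx m0.
have [M hM] := small_tails hp A0 hB (fun=> lexx 0) h0 0 e0.
by rewrite (hM 0%N 0%N)// => x; rewrite /tail_part lexx !if_same addr0 lexx.
Qed.

Lemma pair_lower_neq c c' j l : c <> c' ->
  lower_distributional d B (iter j B (spliced c)) (iter l B (spliced c')) eps
    = 0%E.
Proof.
move=> cc'; have [n /eqP cn] : exists n, c n <> c' n.
  by apply/existsNP => H; apply: cc'; apply/funext.
apply: (@pair_lower _ _ _ _ j) => K.
have [k] := codes_unbounded n (c n) 0 (maxn K (maxn j l)).
rewrite !geq_max => /and3P[Kk jk lk] [q kq]; exists k => // x kx.
have ck : selected c k by rewrite /selected kq.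
have c'k : ~~ selected c' k by rewrite /selected kq eq_sym.
by rewrite (spliced_unselected kx c'k jk lk) subr0 (modulus_spliced kx ck).
Qed.

Lemma pair_lower_lag c j r : (0 < r)%N ->
  lower_distributional d B (iter j B (spliced c)) (iter (j + r) B (spliced c))
    eps = 0%E.
Proof.
move=> r0; apply: (@pair_lower _ _ _ _ j) => K.
have [k] := codes_unbounded 0 (c 0%N) r (maxn K r).
rewrite !geq_max => /andP[Kk rk] [q kq]; exists k => // x kx.
have lk : lag k = r by rewrite /lag kq.
have := @spliced_lag c k _ kx; rewrite /selected kq eqxx lk r0 rk addnA.
by apply.
Qed.

End Blocks.

(** Cantor's diagonal argument, through an injection of D into nat. *)
Lemma uncountable_range_binary T (f : (nat -> bool) -> T) (D : set T) :
  injective f -> (forall c, D (f c)) -> ~ countable D.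
Proof.
move=> finj fD /countable_injP[g ginj].
have gfinj c c' : g (f c) = g (f c') -> c = c'.
  by move/(ginj _ _ (mem_set (fD c)) (mem_set (fD c')))/finj.
pose c0 n := ~~ `[< exists2 c, g (f c) = n & c n >].
have [|] := boolP (c0 (g (f c0))).
  by move=> /[dup] c0t /asboolPn; apply; exists c0.
move=> /[dup] c0f /negPn/asboolP[c /gfinj ->].
by apply/negP.
Qed.

Theorem theorem3 (R : realType) (s : scalar_kind) (A : nat -> nat -> R) (p : R)
    (hA : koethe_matrix A) (hB : shift_condition A)
    (hp : p = 0 \/ 1 <= p)
    (x y : nat -> scalar_field R s) (delta : R)
    (hx : koethe_space p A x) (hy : koethe_space p A y) (hdelta : 0 < delta)
    (hxy : lower_distributional (koethe_dist p A) (@backward_shift R s)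
             x y delta = 0%E)
    (epsilon : R) (heps : 0 < epsilon < delta) :
  exists D : set (nat -> scalar_field R s),
    [/\ D `<=` koethe_space p A,
        ~ countable D,
        invariant_set (@backward_shift R s) D &
        distributionally_scrambled (koethe_dist p A) (@backward_shift R s)
          epsilon D].
Proof.
have p0 : 0 <= p by case: hp => [->//|]; exact: le_trans.
have A0 j k : 0 <= A j k by case: (hA.2 j k).
case/andP: heps => e0 ed.
pose z j := x j - y j.
have hz : profile_space p A (fun j => modulus (z j)).
  have := profile_spaceD p0 A0 (fun j => modulus_ge0 (x j))
    (fun j => modulus_ge0 (y j)) hx hy.
  apply: (sub_profile_space p0 A0) => j.
  by rewrite modulus_ge0 le_modulusB.
have spread k N : exists2 n, (N <= n)%N &
    (k.+1 * \sum_(0 <= i < n)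
      (profile_norm p A (advance i (fun j => modulus (z j))) < delta)%R <= n)%N.
  have [n Nn] := lower_distributional_eq0_ex hxy k N.
  rewrite closeness_countE => h; exists n => //.
  congr (_ * _ <= _)%N : h; apply: eq_bigr => i _.
  by rewrite koethe_distE !iter_backward_shift.
pose B := @backward_shift R s.
pose u := spliced p0 A0 hB hz ed spread.
exists [set v | exists c j, v = iter j B (u c)]; split.
- move=> _ [c [j ->]]; rewrite koethe_spaceE iter_backward_shift.
  apply: (profile_space_advance p0 A0 hB _ (spliced_space _ _ _ _ _ _ c)).
  by move=> i; exact: modulus_ge0.
- apply: (@uncountable_range_binary _ u) => [c c' e|c]; last by exists c, 0%N.
  apply: contrapT => cc'.
  have : lower_distributional (koethe_dist p A) B (u c) (u c') epsilon = 0%E :=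
    pair_lower_neq p0 A0 hB hz ed spread 0 0 cc'.
  rewrite -e; exact: (not_separated_from_self p0 A0 hB hz ed e0).
- move=> _ [_ [c [j ->]] <-]; exists c, j.+1; by rewrite iterS.
move=> _ _ [c [j ->]] [c' [l ->]] neq; split.
  by move=> t t0; exact: pair_upper.
have [ecc|cc'] := pselect (c = c'); last exact: pair_lower_neq.
rewrite -{c'}ecc in neq *.
have [jl|lj|jl] := ltngtP j l; last by rewrite jl in neq.
  by rewrite -(subnKC (ltnW jl)); apply: pair_lower_lag; rewrite subn_gt0.
rewrite lower_distributionalC => [|a b]; last first.
  by rewrite !koethe_distE; congr profile_norm; apply/funext => i;
    rewrite modulusBC.
by rewrite -(subnKC (ltnW lj)); apply: pair_lower_lag; rewrite subn_gt0.
Qed.
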